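(* Let $\mathcal M=(M,<,\ldots)$ be a locally l-visceral structure with properties (A) and (B). Then, for nonempty definable sets: (1) if $X,Y\subseteq M^n$ are definable then $\dim(X\cup Y)=\max\{\dim X,\dim Y\}$; (2) if $\varphi:X\to Y$ is a definable surjective map such that $\dim\varphi^{-1}(y)$ is the same for all $y\in Y$, then $\dim X=\dim Y+\dim\varphi^{-1}(y)$ for all $y\in Y$; (3) if $f:X\to M^n$ is a definable map, then $\dim f(X)\le\dim X$.
   Context: $\mathcal M$ is an expansion of a dense linear order without endpoints; ''definable'' means with parameters; $M$ has the order topology and $M^n$ the product topology. $\mathcal M$ is locally l-visceral if for every definable $X\subseteq M$ and $a\in M$ there is an open interval $I\ni a$ with $X\cap I$ a union of a finite set and an open set. Property (A): the image of a nonempty definable discrete set under a coordinate projection is discrete. Property (B): if $X\subseteq M^{n+1}$ is definable, $\pi:M^{n+1}\to M^n$ forgets the last coordinate, $\pi(X)$ has nonempty interior and $X_x=\{y\in M:(x,y)\in X\}$ has nonempty interior for every $x\in\pi(X)$, then $X$ has nonempty interior. Dimension: for nonempty definable $X\subseteq M^n$, $\dim X$ is the largest $d$ such that $\pi(X)$ has nonempty interior for some coordinate projection $\pi:M^n\to M^d$ ($M^0$ a point); $\dim\emptyset=-\infty$. *)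

(* Defs.v *)
From HB Require Import structures.
From mathcomp Require Import all_boot all_order all_algebra.
From mathcomp Require Import all_classical all_reals all_analysis.

Set Implicit Arguments.
Unset Strict Implicit.
Unset Printing Implicit Defensive.

Local Open Scope classical_set_scope.

(* The symbols of a language other than equality and the order symbol [<],
   which are built into the formulas below. *)
Record language := Language {
  fun_symb : Type;
  fun_ar : fun_symb -> nat;
  rel_symb : Type;
  rel_ar : rel_symb -> nat
}.

Inductive term (L : language) (n : nat) : Type :=
| Var of 'I_n
| App (f : fun_symb L) of ('I_(fun_ar f) -> term L n).

(* [formula L n]: first-order formulas over [{<}] and [L] with free variables
   among n variables; [Ex] binds the last of n + 1 variables. *)
Inductive formula (L : language) : nat -> Type :=
| Lt n of term L n & term L n : formula L n
| Eq n of term L n & term L n : formula L n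
| Rel n (r : rel_symb L) of ('I_(rel_ar r) -> term L n) : formula L n
| Not n of formula L n : formula L n
| And n of formula L n & formula L n : formula L n
| Ex n of formula L (n + 1) : formula L n.

(* M^n is ['rV[M]_n], whose topology in the library is the product topology. *)
Record expansion (L : language) (M : Type) := Expansion {
  fun_interp : forall f : fun_symb L, 'rV[M]_(fun_ar f) -> M;
  rel_interp : forall r : rel_symb L, set 'rV[M]_(rel_ar r)
}.

Section ExpansionsOfLinearOrders.
Context {disp : Order.disp_t} {M : orderTopologicalType disp} {L : language}.
Variable S : expansion L M.

Definition snoc n (x : 'rV[M]_n) (y : M) : 'rV[M]_(n + 1) :=
  row_mx x (const_mx y).

Fixpoint eval n (e : 'rV[M]_n) (t : term L n) : M :=
  match t with
  | Var i => e ord0 i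
  | App f ts => fun_interp S (f := f) (\row_i eval e (ts i))%R
  end.

Fixpoint holds n (p : formula L n) : 'rV[M]_n -> Prop :=
  match p with
  | Lt _ t u => fun e => (eval e t < eval e u)%O
  | Eq _ t u => fun e => eval e t = eval e u
  | Rel _ r ts => fun e => rel_interp S (r := r) (\row_i eval e (ts i))%R
  | Not _ q => fun e => ~ holds q e
  | And _ q r => fun e => holds q e /\ holds r e
  | Ex _ q => fun e => exists a : M, holds q (snoc e a)
  end.

(* Definability with parameters: b is the tuple of parameters. *)
Definition definable n (X : set 'rV[M]_n) : Prop :=
  exists k (p : formula L (n + k)) (b : 'rV[M]_k),
    X = [set x | holds p (row_mx x b)].

Definition definable1 (X : set M) : Prop :=
  definable [set x : 'rV[M]_1 | X (x ord0 ord0)].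

(* A map X -> M^n is represented by a total function of which only the
   restriction to X is used. *)
Definition definable_map m n (X : set 'rV[M]_m) (f : 'rV[M]_m -> 'rV[M]_n)
  : Prop :=
  definable [set row_mx x (f x) | x in X].

(* The coordinate projection x |-> (x_(s 0), ..., x_(s (d - 1))). *)
Definition coord_proj n d (s : 'I_d -> 'I_n) (x : 'rV[M]_n) : 'rV[M]_d :=
  colsub s x.

Definition increasing n d (s : 'I_d -> 'I_n) : Prop :=
  forall i j : 'I_d, i < j -> s i < s j.

Definition has_interior (T : topologicalType) (X : set T) : Prop :=
  X° !=set0.

Definition discrete_in (T : topologicalType) (X : set T) : Prop :=
  X `<=` isolated X.

Definition locally_l_visceral : Prop :=
  forall (X : set M) (a : M), definable1 X ->
    exists I : interval M, [/\ itv_open_ends I, a \in I &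
      exists F U : set M,
        [/\ finite_set F, open U & X `&` [set` I] = F `|` U]].

Definition propertyA : Prop :=
  forall n d (s : 'I_d -> 'I_n) (X : set 'rV[M]_n), increasing s ->
    definable X -> X !=set0 -> discrete_in X ->
    discrete_in (coord_proj s @` X).

Definition fiber n (X : set 'rV[M]_(n + 1)) (x : 'rV[M]_n) : set M :=
  [set y | X (snoc x y)].

Definition propertyB : Prop :=
  forall n (X : set 'rV[M]_(n + 1)), definable X ->
    has_interior (lsubmx @` X) ->
    (forall x, (lsubmx @` X) x -> has_interior (fiber X x)) ->
    has_interior X.

(* Values in [\bar int]. For nonempty X the maximum ranges over a nonempty set
   of d, as the projection to M^0 always qualifies. *)
Definition top_dim n (X : set 'rV[M]_n) : \bar int :=
  if X == set0 then -oo%E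
  else ((\max_(d < n.+1 | `[< exists s : 'I_d -> 'I_n,
             increasing s /\ has_interior (coord_proj s @` X) >]) d)%N%:Z)%:E%E.

End ExpansionsOfLinearOrders.

Definition dense_linear_order_without_endpoints disp (M : orderType disp)
  : Prop :=
  [/\ inhabited M,
      forall x y : M, (x < y)%O -> exists z : M, (x < z)%O /\ (z < y)%O &
      forall x : M, (exists y : M, (y < x)%O) /\ (exists z : M, (x < z)%O)].

(* Main.v *)
(* Fix X in M^n and a set A of coordinates; call X full on A if its projection
   to the coordinates in A contains a box, so that dim X is the largest size of
   such an A. By property (B), X is full on A + i iff the set of z such that
   the x_i with x in X, x = z on A contain an interval is full on A; together
   with local l-viscerality (a definable subset of M without interior is
   discrete and closed), induction on A shows that a union is full on A only if
   one of its terms is.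

   The main point is an exchange principle. Suppose that over each point of
   the projection to E the coordinate x_i takes a set of values without
   interior, and X is full on A + i with A inside E. Fixing the coordinates in
   A, if all coordinates in E \ A took values without interior, then the
   section, projected to E + i, would be discrete, hence by (A) so would be its
   projection to x_i, a contradiction. So some j in E \ A has values with
   interior, and X is full on A + j. Removing fiber coordinates one at a time,
   this bounds dim X by the dimension of the base plus that of the fibers; the
   converse bound follows from (B). Everything else is this addition formula
   applied to the graph of the map, projected to its two blocks of
   coordinates. *)
Require Import Defs.
From mathcomp Require Import all_boot all_order all_algebra.
From mathcomp Require Import all_classical all_reals all_analysis.

Set Implicit Arguments.
Unset Strict Implicit.
Unset Printing Implicit Defensive.

Import Order.TTheory.
Local Open Scope classical_set_scope.

(** * Closure properties of definable sets, at the level of formulas and then of predicates *)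

Section Definability.
Context (disp : Order.disp_t) (M : orderTopologicalType disp) (L : language)
  (S : expansion L M) (M_inh : inhabited M).

Lemma term_reindex n (t : term L n) m (f : 'I_n -> 'I_m) :
  exists u : term L m, forall e, Defs.eval S e u = Defs.eval S (colsub f e) t.
Proof.
elim: t => [i|g ts IH].
  by exists (Var L (f i)) => e /=; rewrite mxE.
have [us Hus] := choice IH.
exists (App us) => e /=; congr (fun_interp S _).
by apply/rowP => i; rewrite !mxE.
Qed.

Lemma formula_reindex n (p : formula L n) m (f : 'I_n -> 'I_m) :
  exists q : formula L m, forall e, holds S q e <-> holds S p (colsub f e).
Proof.
elim: p m f => {n}[n t u|n t u|n r ts|n p IH|n p IHp q IHq|n p IH] m f.
- have [t' Ht] := term_reindex t f; have [u' Hu] := term_reindex u f.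
  by exists (Lt t' u') => e /=; rewrite Ht Hu.
- have [t' Ht] := term_reindex t f; have [u' Hu] := term_reindex u f.
  by exists (Defs.Eq t' u') => e /=; rewrite Ht Hu.
- have [us Hus] := choice (fun i => term_reindex (ts i) f).
  exists (Rel us) => e /=.
  suff -> : (\row_i Defs.eval S e (us i) =
             \row_i Defs.eval S (colsub f e) (ts i))%R by [].
  by apply/rowP => i; rewrite !mxE.
- by have [q Hq] := IH m f; exists (Not q) => e /=; rewrite Hq.
- have [p' Hp] := IHp m f; have [q' Hq] := IHq m f.
  by exists (And p' q') => e /=; rewrite Hp Hq.
(* [Ex] binds the last variable, so [f] is extended by sending last to last. *)
- pose g (i : 'I_(n + 1)) : 'I_(m + 1) :=
    match fintype.split i with inl j => lshift 1 (f j) | inr k => rshift m k end.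
  have gE e (a : M) : colsub g (snoc e a) = snoc (colsub f e) a.
    apply/rowP => i; rewrite !mxE /g; case: (splitP i) => j _ /=.
      by rewrite (unsplitK (inl _)) mxE.
    by rewrite (unsplitK (inr _)) !mxE.
  have [q Hq] := IH _ g; exists (Ex q) => e /=.
  by split=> -[a Ha]; exists a; move: Ha; rewrite Hq gE.
Qed.

(** One form of variable substitution for weakening, permuting and merging tuples. The index type
    [W] is arbitrary so that a tuple may also be built from a point together with the value of a
    quantified variable. *)
Lemma holds_reindex (W : Type) n m (p : formula L n)
    (F : W -> 'rV[M]_n) (G : W -> 'rV[M]_m) :
    (forall j, exists t, forall w, F w ord0 j = G w ord0 t) ->
  exists q : formula L m, forall w, holds S q (G w) <-> holds S p (F w).
Proof.
move=> /choice[f Hf]; have [q Hq] := formula_reindex p f; exists q => w.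
rewrite Hq; suff -> : colsub f (G w) = F w by [].
by apply/rowP => j; rewrite mxE -Hf.
Qed.

(** Constants are allowed because they can be absorbed into the parameters. The resulting
    substitutions need no function symbols. *)
Definition coord_or_cst N (g : 'rV[M]_N -> M) : Prop :=
  (exists i, forall e, g e = e ord0 i) \/ (exists c, forall e, g e = c).

Definition coords_or_csts N n (h : 'rV[M]_N -> 'rV[M]_n) : Prop :=
  forall j, coord_or_cst (fun e => h e ord0 j).

Lemma definable_ext n (X Y : set 'rV[M]_n) :
  (forall x, X x <-> Y x) -> definable S X -> definable S Y.
Proof.
by move=> XY; suff -> : X = Y by []; apply/seteqP; split=> x /XY.
Qed.

Lemma definable_comp N n (X : set 'rV[M]_n) (h : 'rV[M]_N -> 'rV[M]_n) :
  definable S X -> coords_or_csts h -> definable S (fun e => X (h e)).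
Proof.
case: M_inh => c0 [k [p [b ->]]] hh.
(* The constant coordinates of [h] keep their value at the arbitrary point [e0], so [h e0] is added
   to the parameters and each of them is read off from there. *)
pose e0 : 'rV[M]_N := const_mx c0.
have [|q Hq] := @holds_reindex _ _ _ p (fun e => row_mx (h e) b)
    (fun e => row_mx e (row_mx (h e0) b)).
  move=> j; case: (splitP j) => i ij.
    have {ij}-> : j = lshift _ i by apply/val_inj.
    case: (hh i) => [[t Ht]|[c Hc]].
      by exists (lshift _ t) => e; rewrite !row_mxEl.
    exists (rshift _ (lshift _ i)) => e.
    by rewrite row_mxEr !row_mxEl !Hc.
  have {ij}-> : j = rshift _ i by apply/val_inj.
  by exists (rshift _ (rshift _ i)) => e; rewrite !row_mxEr.
exists _, q, (row_mx (h e0) b); apply/seteqP; split => e /=; by rewrite Hq.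
Qed.

Lemma definable_not n (X : set 'rV[M]_n) :
  definable S X -> definable S (fun e => ~ X e).
Proof. by move=> [k [p [b ->]]]; exists k, (Not p), b. Qed.

Lemma definable_and n (X Y : set 'rV[M]_n) :
  definable S X -> definable S Y -> definable S (fun e => X e /\ Y e).
Proof.
move=> [k [p [b ->]]] [k' [p' [b' ->]]].
have [|q Hq] := @holds_reindex _ _ _ p (fun e => row_mx e b)
    (fun e => row_mx e (row_mx b b')).
  move=> j; case: (splitP j) => i ij.
    have {ij}-> : j = lshift _ i by apply/val_inj.
    by exists (lshift _ i) => e; rewrite !row_mxEl.
  have {ij}-> : j = rshift _ i by apply/val_inj.
  by exists (rshift _ (lshift _ i)) => e; rewrite !row_mxEr row_mxEl.
have [|q' Hq'] := @holds_reindex _ _ _ p' (fun e => row_mx e b')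
    (fun e => row_mx e (row_mx b b')).
  move=> j; case: (splitP j) => i ij.
    have {ij}-> : j = lshift _ i by apply/val_inj.
    by exists (lshift _ i) => e; rewrite !row_mxEl.
  have {ij}-> : j = rshift _ i by apply/val_inj.
  by exists (rshift _ (rshift _ i)) => e; rewrite !row_mxEr.
exists _, (And q q'), (row_mx b b').
by apply/seteqP; split => e /=; rewrite Hq Hq'.
Qed.

Lemma definable_or n (X Y : set 'rV[M]_n) :
  definable S X -> definable S Y -> definable S (fun e => X e \/ Y e).
Proof.
move=> dX dY; apply: (@definable_ext _ (fun e => ~ (~ X e /\ ~ Y e))).
  by move=> e; rewrite not_andE !notK.
by apply/definable_not/definable_and; apply: definable_not.
Qed.

Lemma definable_imp n (X Y : set 'rV[M]_n) :
  definable S X -> definable S Y -> definable S (fun e => X e -> Y e).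
Proof.
move=> dX dY; apply: (@definable_ext _ (fun e => ~ X e \/ Y e)).
  by move=> e; split=> [[]//|H]; case: (EM (X e)) => [/H|]; [right|left].
by apply: definable_or => //; apply: definable_not.
Qed.

Lemma definable_exists_last n (X : set 'rV[M]_(n + 1)) :
  definable S X -> definable S (fun e => exists a, X (snoc e a)).
Proof.
move=> [k [p [b ->]]].
have [|q Hq] := @holds_reindex _ _ _ p
    (fun ea : 'rV[M]_n * M => row_mx (snoc ea.1 ea.2) b)
    (fun ea => snoc (row_mx ea.1 b) ea.2).
  move=> j; case: (splitP j) => i ij; last first.
    have {ij}-> : j = rshift _ i by apply/val_inj.
    by exists (lshift _ (rshift _ i)) => e; rewrite row_mxEr row_mxEl row_mxEr.
  have {ij}-> : j = lshift _ i by apply/val_inj.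
  case: (splitP i) => i' ii'.
    have {ii'}-> : i = lshift _ i' by apply/val_inj.
    by exists (lshift _ (lshift _ i')) => e; rewrite !row_mxEl.
  have {ii'}-> : i = rshift _ i' by apply/val_inj.
  by exists (rshift _ i') => e; rewrite row_mxEl !row_mxEr !mxE.
exists k, (Ex q), b; apply/seteqP; split => e /= -[a Ha]; exists a.
  exact/(Hq (e, a)).
by move/(Hq (e, a)) : Ha.
Qed.

Lemma coord_or_cst_entry N n (h : 'rV[M]_N -> 'rV[M]_n) i :
  coords_or_csts h -> coord_or_cst (fun e => h e ord0 i).
Proof. by apply. Qed.

Lemma coord_or_cst_const N c : coord_or_cst (fun _ : 'rV[M]_N => c).
Proof. by right; exists c. Qed.

Lemma coords_or_csts_id N : coords_or_csts (fun e : 'rV[M]_N => e).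
Proof. by move=> j; left; exists j. Qed.

Lemma coords_or_csts_const N n (c : 'rV[M]_n) :
  coords_or_csts (fun _ : 'rV[M]_N => c).
Proof. by move=> j; right; exists (c ord0 j). Qed.

Lemma coords_or_csts_colsub N n m (h : 'rV[M]_N -> 'rV[M]_n) (s : 'I_m -> 'I_n) :
  coords_or_csts h -> coords_or_csts (fun e => colsub s (h e)).
Proof.
move=> hh j; case: (hh (s j)) => [[i Hi]|[c Hc]]; [left; exists i|right; exists c].
  by move=> e; rewrite mxE.
by move=> e; rewrite mxE.
Qed.

Lemma coords_or_csts_lsub N n m (h : 'rV[M]_N -> 'rV[M]_(n + m)) :
  coords_or_csts h -> coords_or_csts (fun e => lsubmx (h e)).
Proof. by rewrite lsubmxEsub; apply: coords_or_csts_colsub. Qed.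

Lemma coords_or_csts_rsub N n m (h : 'rV[M]_N -> 'rV[M]_(n + m)) :
  coords_or_csts h -> coords_or_csts (fun e => rsubmx (h e)).
Proof. by rewrite rsubmxEsub; apply: coords_or_csts_colsub. Qed.

Lemma coords_or_csts_row N n m (h : 'rV[M]_N -> 'rV[M]_n)
    (h' : 'rV[M]_N -> 'rV[M]_m) :
  coords_or_csts h -> coords_or_csts h' ->
  coords_or_csts (fun e => row_mx (h e) (h' e)).
Proof.
move=> hh hh' j; case: (splitP j) => i ij.
  have {ij}-> : j = lshift _ i by apply/val_inj.
  by case: (hh i) => [[t H]|[t H]]; [left|right]; exists t => e; rewrite row_mxEl.
have {ij}-> : j = rshift _ i by apply/val_inj.
by case: (hh' i) => [[t H]|[t H]]; [left|right]; exists t => e; rewrite row_mxEr.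
Qed.

Lemma definable_rel2 N (R : M -> M -> Prop) (f g : 'rV[M]_N -> M) :
    definable S (fun e : 'rV[M]_(1 + 1) => R (e ord0 ord0) (e ord0 ord_max)) ->
    coord_or_cst f -> coord_or_cst g ->
  definable S (fun e => R (f e) (g e)).
Proof.
move=> dR hf hg.
pose h e : 'rV[M]_(1 + 1) := row_mx (const_mx (f e)) (const_mx (g e)).
have E0 e : h e ord0 ord0 = f e.
  transitivity (h e ord0 (lshift 1 ord0)); last by rewrite row_mxEl mxE.
  by congr (h e _ _); apply/val_inj.
have E1 e : h e ord0 ord_max = g e.
  transitivity (h e ord0 (rshift 1 ord0)); last by rewrite row_mxEr mxE.
  by congr (h e _ _); apply/val_inj.
apply: (@definable_ext _ (fun e => R (h e ord0 ord0) (h e ord0 ord_max))).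
  by move=> e; rewrite E0 E1.
apply: (definable_comp dR); apply: coords_or_csts_row => j.
  by case: hf => [[t H]|[t H]]; [left|right]; exists t => e; rewrite mxE.
by case: hg => [[t H]|[t H]]; [left|right]; exists t => e; rewrite mxE.
Qed.

Lemma definable_lt N (f g : 'rV[M]_N -> M) :
  coord_or_cst f -> coord_or_cst g -> definable S (fun e => (f e < g e)%O).
Proof.
case: M_inh => c0; apply: (definable_rel2 (R := fun x y => (x < y)%O)).
exists 0, (Lt (Var L (lshift 0 ord0)) (Var L (lshift 0 ord_max))), (const_mx c0).
by apply/seteqP; split => e /=; rewrite !row_mxEl.
Qed.

Lemma definable_eq N (f g : 'rV[M]_N -> M) :
  coord_or_cst f -> coord_or_cst g -> definable S (fun e => f e = g e).
Proof.
case: M_inh => c0; apply: (definable_rel2 (R := fun x y => x = y)).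
exists 0, (Defs.Eq (Var L (lshift 0 ord0)) (Var L (lshift 0 ord_max))).
exists (const_mx c0).
by apply/seteqP; split => e /=; rewrite !row_mxEl.
Qed.

Lemma definable_true n : definable S (fun _ : 'rV[M]_n => True).
Proof.
case: M_inh => c0; apply: (@definable_ext _ (fun _ => c0 = c0)) => //.
by apply: definable_eq; right; exists c0.
Qed.

Lemma definable_forall_fin n (I : finType) (X : I -> set 'rV[M]_n) :
  (forall i, definable S (X i)) -> definable S (fun e => forall i, X i e).
Proof.
move=> dX.
suff dr (r : seq I) : definable S (fun e => forall i, i \in r -> X i e).
  apply: definable_ext (dr (enum I)) => e; split=> H i; last by move=> _.
  by apply: H; rewrite mem_enum.
elim: r => [|i r IH].
  by apply: definable_ext (definable_true n).
apply: definable_ext (definable_and (dX i) IH) => e; split=> [[Hi Hr] j|H].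
  by rewrite inE => /predU1P[->|/Hr].
by split=> [|j jr]; apply: H; rewrite inE ?eqxx// jr orbT.
Qed.

Lemma definable_exists_fin n (I : finType) (X : I -> set 'rV[M]_n) :
  (forall i, definable S (X i)) -> definable S (fun e => exists i, X i e).
Proof.
move=> dX; apply: (@definable_ext _ (fun e => ~ forall i, ~ X i e)).
  by move=> e; rewrite forallNE notK.
by apply/definable_not/definable_forall_fin => i; apply: definable_not.
Qed.

Lemma definable_if n (b : bool) (X : set 'rV[M]_n) :
  (b -> definable S X) -> definable S (fun e => b -> X e).
Proof.
case: b => dX; last by apply: definable_ext (definable_true n).
by apply: definable_ext (dX isT) => e; split=> [//|]; apply.
Qed.

(** Since [P] does not depend on the point, the set is either [X] or empty. *)
Lemma definable_guard n (P : Prop) (X : set 'rV[M]_n) :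
  (P -> definable S X) -> definable S (fun e => P /\ X e).
Proof.
move=> dX; case: (EM P) => [p|np].
  by apply: definable_ext (dX p) => e; split=> [|[]].
apply: (@definable_ext _ (fun _ => ~ True)) => [e|]; first by split=> // -[].
exact/definable_not/definable_true.
Qed.

(** A definable family, uniformly in its index: this is what quantification over a whole tuple
    requires. *)
Definition definable2 n m (X : 'rV[M]_n -> set 'rV[M]_m) : Prop :=
  definable S (fun e : 'rV[M]_(n + m) => X (lsubmx e) (rsubmx e)).

Lemma definable2_comp N n m (X : 'rV[M]_n -> set 'rV[M]_m) f g :
  definable2 X -> coords_or_csts f -> coords_or_csts g ->
  definable S (fun e : 'rV[M]_N => X (f e) (g e)).
Proof.
move=> dX hf hg; apply: definable_ext (definable_comp dX (coords_or_csts_row hf hg)).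
by move=> e /=; rewrite row_mxKl row_mxKr.
Qed.

Lemma definable_exists n k (X : 'rV[M]_n -> set 'rV[M]_k) :
  definable2 X -> definable S (fun x => exists b, X x b).
Proof.
elim: k n X => [|k IH] n X dX.
  case: M_inh => c0; apply: (@definable_ext _ (fun x => X x (const_mx c0))).
    move=> x; split=> [Hx|[b]]; first by exists (const_mx c0).
    by rewrite (_ : b = const_mx c0)//; apply/rowP => -[].
  apply: definable2_comp dX _ _; first exact: coords_or_csts_id.
  exact: coords_or_csts_const.
(* The first coordinate of the quantified tuple is moved to the end of the index, where [Ex] can
   bind it. It is the first one because [1 + k] is convertible to [k.+1]. *)
pose Y (w : 'rV[M]_(n + 1)) (b : 'rV[M]_k) :=
  X (lsubmx w) (row_mx (rsubmx w) b : 'rV_(1 + k)).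
have dY : definable2 Y.
  by apply: definable2_comp dX _ _; [|apply: (@coords_or_csts_row _ 1 k)];
    do ?[apply: coords_or_csts_lsub|apply: coords_or_csts_rsub];
    apply: coords_or_csts_id.
apply: definable_ext (definable_exists_last (IH _ _ dY)) => x.
rewrite /Y /snoc; split=> [[a [b Hb]]|[b Hb]].
  by exists (row_mx (const_mx a) b : 'rV_(1 + k)); rewrite row_mxKl row_mxKr in Hb.
pose b' : 'rV[M]_(1 + k) := b.
exists (b' ord0 ord0), (rsubmx b'); rewrite row_mxKl row_mxKr.
suff -> : const_mx (b' ord0 ord0) = lsubmx b' by rewrite hsubmxK.
by apply/rowP => i; rewrite !mxE; congr (b' _ _); apply/val_inj; rewrite ord1.
Qed.

Lemma definable_forall n k (X : 'rV[M]_n -> set 'rV[M]_k) :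
  definable2 X -> definable S (fun x => forall b, X x b).
Proof.
move=> dX; apply: (@definable_ext _ (fun x => ~ exists b, ~ X x b)).
  move=> x; rewrite -forallNE; split=> H b.
    exact: contrapT (H b).
  by apply; exact: H.
by apply/definable_not/definable_exists/definable_not.
Qed.

Lemma definable_exists1 n (X : 'rV[M]_n -> set M) :
  definable S (fun e : 'rV[M]_(n + 1) => X (lsubmx e) (rsubmx e ord0 ord0)) ->
  definable S (fun x => exists a, X x a).
Proof.
move=> dX.
apply: definable_ext (@definable_exists n 1 (fun x b => X x (b ord0 ord0)) dX).
move=> x; split=> [[b Hb]|[a Ha]]; first by exists (b ord0 ord0).
by exists (const_mx a); rewrite mxE.
Qed.

Lemma definable_forall1 n (X : 'rV[M]_n -> set M) :
  definable S (fun e : 'rV[M]_(n + 1) => X (lsubmx e) (rsubmx e ord0 ord0)) ->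
  definable S (fun x => forall a, X x a).
Proof.
move=> dX.
apply: definable_ext (@definable_forall n 1 (fun x b => X x (b ord0 ord0)) dX).
by move=> x; split=> Hx a; [have := Hx (const_mx a); rewrite mxE|apply: Hx].
Qed.

End Definability.

Ltac coords := solve [repeat first
  [ assumption | apply: coord_or_cst_entry | apply: coords_or_csts_id
  | apply: coords_or_csts_lsub | apply: coords_or_csts_rsub
  | apply: coords_or_csts_row
  | apply: coords_or_csts_const | apply: coord_or_cst_const ]].

(** * Intervals, boxes and definable subsets of the line *)

Section Boxes.
Context (disp : Order.disp_t) (M : orderTopologicalType disp).
Implicit Types (a : M) (P Q : set M).

(** Nonempty interior in first-order form, which makes it a definable condition on the members of a
    definable family; [has_interior_itv] links it to the topology. *)
Definition has_itv (P : set M) : Prop :=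
  exists l r, (l < r)%O /\ forall y, (l < y)%O -> (y < r)%O -> P y.

Definition box n (l r z : 'rV[M]_n) : Prop :=
  forall i, (l ord0 i < z ord0 i)%O /\ (z ord0 i < r ord0 i)%O.

Definition below n (l r : 'rV[M]_n) : Prop :=
  forall i, (l ord0 i < r ord0 i)%O.

Lemma has_itvS P Q : P `<=` Q -> has_itv P -> has_itv Q.
Proof.
by move=> PQ [l [r [lr H]]]; exists l, r; split=> // y ly yr; apply/PQ/H.
Qed.

Context (hdlo : dense_linear_order_without_endpoints M).

Lemma dlo_inhabited : inhabited M. Proof. by case: hdlo. Qed.

Lemma dlo_dense (x y : M) : (x < y)%O -> exists z, (x < z)%O /\ (z < y)%O.
Proof. by case: hdlo => _ + _; apply. Qed.

Lemma dlo_below (x : M) : exists y, (y < x)%O.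
Proof. by case: hdlo => _ _ /(_ x)[]. Qed.

Lemma dlo_above (x : M) : exists y, (x < y)%O.
Proof. by case: hdlo => _ _ /(_ x)[]. Qed.

Lemma open_itv_around (I : interval M) a : itv_open_ends I -> a \in I ->
  exists l r, [/\ (l < a)%O, (a < r)%O &
    forall y, (l < y)%O -> (y < r)%O -> y \in I].
Proof.
have [l0 l0a] := dlo_below a; have [r0 ar0] := dlo_above a.
case: I => [[[]l|[]] [[]r|[]]] // _; rewrite !in_itv /=.
- move=> /andP[la ar]; exists l, r; split=> // y ly yr.
  by rewrite in_itv /= ly yr.
- by move=> /andP[la ar]; exists l, r0; split=> // y ly yr; rewrite in_itv /= ly.
- by move=> ar; exists l0, r; split=> // y ly yr; rewrite in_itv /= yr.
- by move=> _; exists l0, r0; split.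
Qed.

Lemma nbhs_itv a V : nbhs a V ->
  exists l r, [/\ (l < a)%O, (a < r)%O &
    forall y, (l < y)%O -> (y < r)%O -> V y].
Proof.
rewrite itv_nbhsE => -[I [oI aI] IV].
have [l [r [la ar H]]] := open_itv_around oI aI.
by exists l, r; split=> // y ly yr; apply: IV; apply: H.
Qed.

Lemma itv_nbhs (l r a : M) : (l < a)%O -> (a < r)%O ->
  nbhs a [set y | (l < y)%O /\ (y < r)%O].
Proof.
move=> la ar; rewrite itv_nbhsE; exists `]l, r[%O.
  by split=> //; rewrite in_itv /= la ar.
by move=> y /=; rewrite in_itv /= => /andP.
Qed.

Lemma has_interior_itv P : has_interior P <-> has_itv P.
Proof.
split=> [[a /nbhs_itv[l [r [la ar H]]]]|[l [r [lr H]]]].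
  by exists l, r; split=> //; apply: lt_trans ar.
have [a [la ar]] := dlo_dense lr; exists a.
by apply: filterS (itv_nbhs la ar) => y [ly yr]; apply: H.
Qed.

Lemma box_nbhs n (l r x : 'rV[M]_n) : box l r x -> nbhs x (box l r).
Proof.
move=> bx; exists (fun _ j => [set y | (l ord0 j < y)%O /\ (y < r ord0 j)%O]).
  by move=> i j; rewrite (ord1 i); have [lx xr] := bx j; apply: itv_nbhs.
by move=> z H j; apply: H.
Qed.

Lemma nbhs_box n (x : 'rV[M]_n) V : nbhs x V ->
  exists l r, box l r x /\ box l r `<=` V.
Proof.
move=> [P nP PV].
have /choice[lr Hlr] : forall j, exists lr : M * M,
    [/\ (lr.1 < x ord0 j)%O, (x ord0 j < lr.2)%O &
    forall y, (lr.1 < y)%O -> (y < lr.2)%O -> P ord0 j y].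
  by move=> j; have [l [r H]] := nbhs_itv (nP ord0 j); exists (l, r).
exists (\row_j (lr j).1)%R, (\row_j (lr j).2)%R; split.
  by move=> j; rewrite !mxE; have [] := Hlr j.
move=> z bz; apply: PV => i j; rewrite (ord1 i); have [_ _] := Hlr j.
by have := bz j; rewrite !mxE => -[? ?]; apply.
Qed.

Lemma below_box n (l r : 'rV[M]_n) : below l r -> exists z, box l r z.
Proof.
move=> lr; have /choice[z Hz] := fun i => dlo_dense (lr i).
by exists (\row_i z i)%R => i; rewrite mxE.
Qed.

Lemma box_below n (l r z : 'rV[M]_n) : box l r z -> below l r.
Proof. by move=> bz i; have [lz zr] := bz i; apply: lt_trans zr. Qed.

Lemma has_interior_box n (X : set 'rV[M]_n) :
  has_interior X <-> exists l r, below l r /\ box l r `<=` X.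
Proof.
split=> [[x /nbhs_box[l [r [bx H]]]]|[l [r [lr H]]]].
  by exists l, r; split=> //; apply: box_below bx.
have [z bz] := below_box lr; exists z.
by apply: filterS H _; apply: box_nbhs.
Qed.

Lemma discrete_in_box n (X : set 'rV[M]_n) :
  (forall x, X x -> exists l r, box l r x /\ forall z, X z -> box l r z -> z = x) ->
  discrete_in X.
Proof.
move=> H x Xx; split; first exact/mem_set.
have [l [r [bx Hx]]] := H x Xx; exists (box l r); first exact: box_nbhs.
apply/seteqP; split=> [z [bz Xz]|z ->]; first exact: Hx.
by split.
Qed.

(** A point [c] inside the interval would be isolated in the projection, but by density there are
    points of the interval just above [c]. *)
Lemma coord_not_itv n (X : set 'rV[M]_n) (i : 'I_n) :
  discrete_in (coord_proj (fun _ : 'I_1 => i) @` X) ->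
  ~ has_itv [set y | exists2 x, X x & x ord0 i = y].
Proof.
set D := coord_proj _ @` X => dD [l [r [lr H]]].
have HD y : (l < y)%O -> (y < r)%O -> D (const_mx y).
  move=> ly yr; have [x Xx xi] := H y ly yr; exists x => //.
  by apply/rowP => j; rewrite !mxE.
have [c [lc cr]] := dlo_dense lr.
have [_ [V /nbhs_box[l' [r' [bc bV]]] VD]] := dD _ (HD c lc cr).
have := bc ord0; rewrite mxE => -[l'c cr'].
have [y [cy yrr']] : exists y, (c < y)%O /\ (y < Order.min r (r' ord0 ord0))%O.
  by apply: dlo_dense; rewrite lt_min cr cr'.
move: yrr'; rewrite lt_min => /andP[yr yr'].
have : (V `&` D) (const_mx y).
  split; last by apply: HD => //; apply: lt_trans cy.
  by apply: bV => j; rewrite mxE (ord1 j); split=> //; apply: lt_trans cy.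
rewrite VD => /rowP/(_ ord0); rewrite !mxE => yc.
by rewrite yc ltxx in cy.
Qed.

Context (L : language) (S : expansion L M) (hvisc : locally_l_visceral S).

(** In the local decomposition at [a] the open part is empty, since [P] has no interior, and the
    points of the finite part other than [a] can be avoided. At points of [P] this gives
    discreteness, at the others closedness. *)
Lemma isolating_itv P a : definable1 S P -> ~ has_itv P ->
  exists l r, [/\ (l < a)%O, (a < r)%O &
    forall y, (l < y)%O -> (y < r)%O -> P y -> y = a].
Proof.
move=> dP nP; have [I [oI aI [F [U [fF oU PI]]]]] := hvisc a dP.
have [l0 [r0 [l0a ar0 HI]]] := open_itv_around oI aI.
have nU u : ~ U u.
  move=> Uu; apply: nP; apply/has_interior_itv; exists u.
  apply: filterS (open_nbhs_nbhs (conj oU Uu)) => y Uy.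
  by have : (F `|` U) y by [right]; rewrite -PI => -[].
have /finite_seqP[s sF] := fF.
(* The interval is shrunk past the elements of the list one at a time. *)
have [l [r [la ar Hs]]] : exists l r, [/\ (l < a)%O, (a < r)%O &
    forall y, (l < y)%O -> (y < r)%O -> y \in s -> y = a].
  elim: s {sF} => [|b s [l [r [la ar IH]]]]; first by exists l0, r0; split.
  case: (ltgtP a b) => [ab|ba|<-].
  - exists l, (Order.min r b); split; rewrite ?lt_min ?ar// => y ly.
    rewrite lt_min => /andP[yr yb]; rewrite inE => /predU1P[yb'|]; last exact: IH.
    by rewrite yb' ltxx in yb.
  - exists (Order.max l b), r; split; rewrite ?gt_max ?la// => y.
    rewrite gt_max => /andP[ly yb] yr; rewrite inE => /predU1P[yb'|]; last exact: IH.
    by rewrite yb' ltxx in yb.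
  - exists l, r; split=> // y ly yr; rewrite inE => /predU1P[//|]; exact: IH.
exists (Order.max l l0), (Order.min r r0).
split; rewrite ?gt_max ?lt_min ?la ?ar// => y.
rewrite gt_max lt_min => /andP[ly l0y] /andP[yr yr0] Py; apply: Hs => //.
have : (P `&` [set` I]) y by split=> //; apply: HI.
by rewrite PI => -[|/nU//]; rewrite sF.
Qed.

(** If neither set contained an interval, both would reduce to at most [a] near a point [a] of the
    given interval, leaving nearby points of the interval uncovered. *)
Lemma has_itvU P Q : definable1 S P -> definable1 S Q ->
  has_itv (fun y => P y \/ Q y) -> has_itv P \/ has_itv Q.
Proof.
move=> dP dQ [l [r [lr H]]]; apply: contrapT => /not_orP[nP nQ].
have [a [la ar]] := dlo_dense lr.
have [l1 [r1 [l1a ar1 H1]]] := isolating_itv a dP nP.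
have [l2 [r2 [l2a ar2 H2]]] := isolating_itv a dQ nQ.
have [y [ay]] : exists y, (a < y)%O /\ (y < Order.min r (Order.min r1 r2))%O.
  by apply: dlo_dense; rewrite !lt_min ar ar1 ar2.
rewrite !lt_min => /and3P[yr yr1 yr2].
have neq : y <> a by move=> ya; rewrite ya ltxx in ay.
have [Py|Qy] := H y (lt_trans la ay) yr; apply: neq.
  by apply: H1 => //; apply: lt_trans ay.
by apply: H2 => //; apply: lt_trans ay.
Qed.

End Boxes.

(** * Sets of coordinates on which the projection contains a box *)

Section Fullness.
Context (disp : Order.disp_t) (M : orderTopologicalType disp).

Definition agree n (A : {set 'I_n}) (x z : 'rV[M]_n) : Prop :=
  forall i, i \in A -> x ord0 i = z ord0 i.

(** The box is taken in the whole of [M^n], but only its sides in [A] matter. With a fixed ambient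
    space, induction on [A] needs no reindexing. *)
Definition full n (X : set 'rV[M]_n) (A : {set 'I_n}) : Prop :=
  exists l r, below l r /\ forall z, box l r z -> exists x, X x /\ agree A x z.

(** A cylinder over the coordinates in [A] (see [shadow_agree]), kept in [M^n] for the same
    reason. *)
Definition shadow n (X : set 'rV[M]_n) (A : {set 'I_n}) (i : 'I_n) :
    set 'rV[M]_n :=
  fun z => has_itv (fun y => exists x, X x /\ agree A x z /\ x ord0 i = y).

Definition update n (z : 'rV[M]_n) (i : 'I_n) (y : M) : 'rV[M]_n :=
  (\row_j if j == i then y else z ord0 j)%R.

(** For injective [s], a section of [coord_proj s] that takes the missing coordinates from [z]. *)
Definition extend d n (s : 'I_d -> 'I_n) (v : 'rV[M]_d) (z : 'rV[M]_n) :
    'rV[M]_n :=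
  (\row_i if [pick j | s j == i] is Some j then v ord0 j else z ord0 i)%R.

Lemma agree_sym n (A : {set 'I_n}) x z : agree A x z -> agree A z x.
Proof. by move=> xz i iA; rewrite xz. Qed.

Lemma agree_trans n (A : {set 'I_n}) x y z :
  agree A x y -> agree A y z -> agree A x z.
Proof. by move=> xy yz i iA; rewrite xy ?yz. Qed.

Lemma agreeS n (A B : {set 'I_n}) x z :
  A \subset B -> agree B x z -> agree A x z.
Proof. by move=> /fintype.subsetP AB xz i /AB; apply: xz. Qed.

Lemma agree_update n (A : {set 'I_n}) z i y :
  i \notin A -> agree A (update z i y) z.
Proof.
move=> iA j jA; rewrite mxE; case: eqVneq => // ji.
by rewrite -ji jA in iA.
Qed.

Lemma fullS n (X Y : set 'rV[M]_n) (A B : {set 'I_n}) :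
  X `<=` Y -> A \subset B -> full X B -> full Y A.
Proof.
move=> XY AB [l [r [lr H]]]; exists l, r; split=> // z /H[x [Xx xz]].
by exists x; split; [apply: XY|apply: agreeS xz].
Qed.

Lemma shadowS n (X Y : set 'rV[M]_n) A i :
  X `<=` Y -> shadow X A i `<=` shadow Y A i.
Proof.
by move=> XY z; apply: has_itvS => y [x [/XY Yx H]]; exists x.
Qed.

Lemma shadow_agree n (X : set 'rV[M]_n) A i x z :
  agree A x z -> shadow X A i x -> shadow X A i z.
Proof.
move=> xz; apply: has_itvS => y [p [Xp [px pi]]]; exists p; split=> //.
by split=> //; apply: agree_trans xz.
Qed.

Lemma extend_coord d n (s : 'I_d -> 'I_n) (v : 'rV[M]_d) (z : 'rV[M]_n) j :
  injective s -> extend s v z ord0 (s j) = v ord0 j.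
Proof.
move=> sI; rewrite mxE; case: pickP => [k /eqP/sI->//|/(_ j)].
by rewrite eqxx.
Qed.

Lemma extend_prop d n (s : 'I_d -> 'I_n) (v : 'rV[M]_d) (z : 'rV[M]_n)
    (R : 'I_n -> M -> Prop) i :
  (forall j, R (s j) (v ord0 j)) -> R i (z ord0 i) ->
  R i (extend s v z ord0 i).
Proof.
by move=> Rv Rz; rewrite mxE; case: pickP => [j /eqP <-|_].
Qed.

Context (hdlo : dense_linear_order_without_endpoints M).
Let inh := dlo_inhabited hdlo.

Lemma exists_below n : exists l r : 'rV[M]_n, below l r.
Proof.
case: inh => c; have [d cd] := dlo_above hdlo c.
by exists (const_mx c), (const_mx d) => i; rewrite !mxE.
Qed.

Lemma full_nonempty n (X : set 'rV[M]_n) A : full X A -> X !=set0.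
Proof.
move=> [l [r [lr H]]]; have [z /H[x [Xx _]]] := below_box hdlo lr.
by exists x.
Qed.

Lemma full0 n (X : set 'rV[M]_n) : X !=set0 -> full X finset.set0.
Proof.
move=> [x Xx]; have [l [r lr]] := exists_below n; exists l, r; split=> // z _.
by exists x; split=> // i; rewrite inE.
Qed.

(** Boxes go down by [colsub s] and up by [extend s]. Together with [full_setT], this translates
    between [full] and interiors of coordinate projections. *)
Lemma full_imset d n (s : 'I_d -> 'I_n) (X : set 'rV[M]_n) (A : {set 'I_d}) :
  injective s -> full X (s @: A) <-> full (coord_proj s @` X) A.
Proof.
move=> sI; split=> -[l [r [lr H]]].
  exists (colsub s l), (colsub s r); split=> [j|v bv]; first by rewrite !mxE.
  have [z0 bz0] := below_box hdlo lr.
  have [i|x [Xx xz]] := H (extend s v z0).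
    apply: (@extend_prop _ _ _ _ _ (fun i y =>
      (l ord0 i < y)%O /\ (y < r ord0 i)%O)) => // j.
    by have := bv j; rewrite !mxE.
  exists (coord_proj s x); split=> [|j jA]; first by exists x.
  by rewrite mxE xz ?imset_f//; apply: extend_coord.
have [l0 [r0 lr0]] := exists_below n.
exists (extend s l l0), (extend s r r0); split=> [i|z bz].
  by rewrite !mxE; case: pickP => [j _|_].
have [|_ [[x Xx <-] xz]] := H (colsub s z).
  by move=> j; have := bz (s j); rewrite !extend_coord// mxE.
exists x; split=> // _ /imsetP[j jA ->].
by have := xz j jA; rewrite !mxE.
Qed.

Lemma full_setT n (X : set 'rV[M]_n) : full X [set: 'I_n]%SET <-> has_interior X.
Proof.
rewrite (has_interior_box hdlo); split=> -[l [r [lr H]]]; exists l, r; split=> // z.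
  move=> /H[x [Xx xz]]; suff -> : z = x by [].
  by apply/rowP => j; rewrite xz// inE.
by move=> /H Xz; exists z.
Qed.

(** The side of the box in direction [i] is itself the interval required by the shadow. The
    converse, [full_setU1], is where (B) enters. *)
Lemma full_shadow n (X : set 'rV[M]_n) (A : {set 'I_n}) i : i \notin A ->
  full X (i |: A) -> full (shadow X A i) A.
Proof.
move=> iA [l [r [lr H]]]; exists l, r; split=> // z bz; exists z; split=> //.
exists (l ord0 i), (r ord0 i); split=> // y ly yr.
have [j|x [Xx xz]] := H (update z i y).
  by rewrite mxE; case: eqVneq => [->|].
exists x; split=> //; split; last by rewrite xz ?finset.setU11// mxE eqxx.
apply: agree_trans (agree_update z y iA); apply: agreeS xz; exact: finset.subsetUr.
Qed.

Context (L : language) (S : expansion L M).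

Lemma definable_agree N n (A : {set 'I_n}) (f g : 'rV[M]_N -> 'rV[M]_n) :
  coords_or_csts f -> coords_or_csts g ->
  definable S (fun e => agree A (f e) (g e)).
Proof.
move=> hf hg; apply: (definable_forall_fin inh) => i.
by apply: (definable_if inh) => _; apply: (definable_eq S inh).
Qed.

Lemma definable2_comp1 N n (X : 'rV[M]_n -> set M) f g :
  definable S (fun e : 'rV[M]_(n + 1) => X (lsubmx e) (rsubmx e ord0 ord0)) ->
  coords_or_csts f -> coord_or_cst g ->
  definable S (fun e : 'rV[M]_N => X (f e) (g e)).
Proof.
move=> dX hf hg.
have := definable2_comp inh (X := fun x b => X x (b ord0 ord0)) dX hf.
move=> /(_ (fun e => const_mx (g e))) H.
apply: definable_ext (H _) => [x|j]; first by rewrite mxE.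
by case: hg => [[i Hi]|[c Hc]]; [left; exists i|right; exists c] => e; rewrite mxE.
Qed.

Lemma definable_has_itv n (P : 'rV[M]_n -> set M) :
  definable S (fun e : 'rV[M]_(n + 1) => P (lsubmx e) (rsubmx e ord0 ord0)) ->
  definable S (fun x => has_itv (P x)).
Proof.
move=> dP; apply: (definable_exists1 inh); apply: (definable_exists1 inh).
apply: definable_and; first by apply: (definable_lt S inh); coords.
apply: (definable_forall1 inh); apply: definable_imp.
  by apply: (definable_lt S inh); coords.
apply: definable_imp; first by apply: (definable_lt S inh); coords.
by apply: (definable2_comp1 dP); coords.
Qed.

Lemma definable2_full n m (X : 'rV[M]_n -> set 'rV[M]_m) A :
  definable2 S X -> definable S (fun u => full (X u) A).
Proof.
move=> dX; apply: (definable_exists inh); apply: (definable_exists inh).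
apply: definable_and.
  by apply: (definable_forall_fin inh) => i; apply: (definable_lt S inh); coords.
apply: (definable_forall inh); apply: definable_imp.
  apply: (definable_forall_fin inh) => i.
  by apply: definable_and; apply: (definable_lt S inh); coords.
apply: (definable_exists inh); apply: definable_and.
  by apply: (definable2_comp inh dX); coords.
by apply: definable_agree; coords.
Qed.

Lemma definable_shadow n (X : set 'rV[M]_n) A i :
  definable S X -> definable S (shadow X A i).
Proof.
move=> dX; apply: definable_has_itv; apply: (definable_exists inh).
apply: definable_and; first by apply: (definable_comp inh dX); coords.
apply: definable_and; first by apply: definable_agree; coords.
by apply: (definable_eq S inh); coords.
Qed.

Lemma definable1_section n (X : set 'rV[M]_n) A z i : definable S X ->
  definable1 S (fun y => exists x, X x /\ agree A x z /\ x ord0 i = y).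
Proof.
move=> dX; apply: (definable_exists inh).
apply: definable_and; first by apply: (definable_comp inh dX); coords.
apply: definable_and; first by apply: definable_agree; coords.
by apply: (definable_eq S inh); coords.
Qed.

Lemma definable_proj d n (s : 'I_d -> 'I_n) (X : set 'rV[M]_n) :
  definable S X -> definable S (coord_proj s @` X).
Proof.
move=> dX; apply: (@definable_ext _ _ _ _ _
    (fun w => exists x, X x /\ forall j, x ord0 (s j) = w ord0 j)) => [w|].
  split=> [[x [Xx xw]]|[x Xx <-]]; exists x => //.
    by apply/rowP => j; rewrite mxE.
  by split=> // j; rewrite mxE.
apply: (definable_exists inh); apply: definable_and.
  by apply: (definable_comp inh dX); coords.
by apply: (definable_forall_fin inh) => j; apply: (definable_eq S inh); coords.
Qed.

Context (hB : propertyB S).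

(** Property (B), applied to the projection to [A] and [i], restated for sets of coordinates. *)
Lemma full_setU1 n (X : set 'rV[M]_n) (A : {set 'I_n}) i :
  definable S X -> i \notin A -> full (shadow X A i) A -> full X (i |: A).
Proof.
move=> dX iA fX.
(* The coordinate [i] is listed last, since (B) forgets the last coordinate. *)
pose s (k : 'I_(#|A| + 1)) :=
  match fintype.split k with inl j => enum_val j | inr _ => i end.
have sl j : s (lshift 1 j) = enum_val j by rewrite /s (unsplitK (inl _)).
have sr j : s (rshift _ j) = i by rewrite /s (unsplitK (inr _)).
have sI : injective s.
  move=> j k; rewrite -(splitK j) -(splitK k).
  case: (fintype.split j) => a; case: (fintype.split k) => b /=;
    rewrite ?sl ?sr.
  - by move=> /enum_val_inj ->.
  - by move=> ai; rewrite -ai enum_valP in iA.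
  - by move=> bi; rewrite bi enum_valP in iA.
  - by rewrite (ord1 a) (ord1 b).
have sE : s @: [set: 'I_(#|A| + 1)]%SET = i |: A.
  apply/finset.setP => j; rewrite !inE; apply/imsetP/predU1P => [[k _ ->]|[->|jA]].
  - rewrite -(splitK k); case: (fintype.split k) => a /=; rewrite ?sl ?sr.
      by right; apply: enum_valP.
    by left.
  - by exists (rshift _ ord0); rewrite ?sr.
  - by exists (lshift _ (enum_rank_in jA j)); rewrite ?sl ?enum_rankK_in.
have eE : (@enum_val _ (mem A)) @: [set: 'I_#|A|]%SET = A.
  apply/finset.setP => j; apply/imsetP/idP => [[k _ ->]|jA]; first exact: enum_valP.
  by exists (enum_rank_in jA j); rewrite ?enum_rankK_in.
(* Property (B) asks for interior in every nonempty fiber, so the points of [X] outside the shadow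
   are discarded. *)
pose Y x := X x /\ shadow X A i x.
have dY : definable S Y by apply: definable_and => //; apply: definable_shadow.
have lsubE x : lsubmx (coord_proj s x) = coord_proj enum_val x.
  by apply/rowP => j; rewrite !mxE sl.
suff : full Y (i |: A) by apply: fullS => // x [].
rewrite -sE; apply/full_imset => //; apply/full_setT.
apply: hB; first exact: definable_proj.
  have -> : lsubmx @` (coord_proj s @` Y) = coord_proj enum_val @` Y.
    apply/seteqP; split=> [_ [_ [x Yx <-] <-]|_ [x Yx <-]].
      by rewrite lsubE; exists x.
    by exists (coord_proj s x); [exists x|apply: lsubE].
  apply/full_setT/full_imset; first exact: enum_val_inj.
  rewrite eE; have [l [r [lr H]]] := fX; exists l, r; split=> // z /H[p [sp pz]].
  have [a [b [ab Hab]]] := sp; have [y [ay yb]] := dlo_dense hdlo ab.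
  have [x [Xx [xp _]]] := Hab y ay yb; exists x; split; last exact: agree_trans pz.
  by split=> //; apply: shadow_agree sp; apply: agree_sym.
move=> _ [_ [x [Xx sx] <-] <-]; rewrite lsubE; apply/(has_interior_itv hdlo).
apply: has_itvS (sx) => y [x' [Xx' [x'x x'i]]]; exists x'.
  by split=> //; apply: shadow_agree sx; apply: agree_sym.
apply/rowP => j; rewrite -(splitK j); case: (fintype.split j) => a /=.
  by rewrite row_mxEl !mxE sl x'x// enum_valP.
by rewrite row_mxEr !mxE sr.
Qed.

Context (hvisc : locally_l_visceral S).

Lemma shadowU n (X Y : set 'rV[M]_n) A i z : definable S X -> definable S Y ->
  shadow (fun x => X x \/ Y x) A i z -> shadow X A i z \/ shadow Y A i z.
Proof.
move=> dX dY H.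
apply: (has_itvU hdlo hvisc); [exact: definable1_section|exact: definable1_section|].
by apply: has_itvS H => y [x [[Xx|Yx] H]]; [left|right]; exists x.
Qed.

(** Induction on the size of [A]: the shadow of a union lies in the union of the shadows, by the
    one-variable case, and [full_setU1] lifts the conclusion back. *)
Lemma fullU n (X Y : set 'rV[M]_n) A : definable S X -> definable S Y ->
  full (fun x => X x \/ Y x) A -> full X A \/ full Y A.
Proof.
elim: {A}#|A| {-2}A (erefl #|A|) X Y => [|k IH] A cA X Y dX dY.
  move: cA => /eqP; rewrite cards_eq0 => /eqP ->.
  by move=> /full_nonempty[x [Xx|Yx]]; [left|right]; apply: full0; exists x.
have /card_gt0P[i iA] : (0 < #|A|)%N by rewrite cA.
have iA' : i \notin A :\ i by rewrite !inE eqxx.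
rewrite -(finset.setD1K iA) => /(full_shadow iA') fXY.
have cA' : #|A :\ i| = k by apply: succn_inj; rewrite -cA (cardsD1 i A) iA.
have : full (fun z => shadow X (A :\ i) i z \/ shadow Y (A :\ i) i z) (A :\ i).
  by apply: fullS fXY => // z; apply: shadowU.
move=> /(IH _ cA' _ _ (definable_shadow _ _ dX) (definable_shadow _ _ dY)).
by case=> /full_setU1 H; [left|right]; apply: H.
Qed.

Lemma full_exists (I : finType) n (X : I -> set 'rV[M]_n) A :
  (forall c, definable S (X c)) ->
  full (fun x => exists c, X c x) A -> exists c, full (X c) A.
Proof.
move=> dX fX.
suff Hs (s : seq I) : full (fun x => exists2 c, c \in s & X c x) A ->
    exists c, full (X c) A.
  apply: (Hs (enum I)); apply: fullS fX => // x [c Xc].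
  by exists c; rewrite ?mem_enum.
elim: s => [/full_nonempty[x []//]|c s IH fs].
have ds : definable S (fun x => exists2 c, c \in s & X c x).
  apply: (@definable_ext _ _ _ _ _ (fun x => exists c, (c \in s) /\ X c x)).
    by move=> x; split=> [[d [? ?]]|[d ? ?]]; exists d.
  by apply: (definable_exists_fin inh) => d; apply: (definable_guard inh) => _.
have : full (fun x => X c x \/ exists2 c, c \in s & X c x) A.
  apply: fullS fs => // x [d]; rewrite inE => /predU1P[->|ds' Xd]; first by left.
  by right; exists d.
by move=> /(fullU (dX c) ds)[|/IH//]; exists c.
Qed.

End Fullness.

(** * Exchange of coordinates and the two inequalities of the addition formula *)

Section Additivity.
Context (disp : Order.disp_t) (M : orderTopologicalType disp) (L : language)
  (S : expansion L M) (hdlo : dense_linear_order_without_endpoints M)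
  (hvisc : locally_l_visceral S) (hA : propertyA S) (hB : propertyB S).
Let inh := dlo_inhabited hdlo.

Lemma definable_cylinder n (X : set 'rV[M]_n) (E : {set 'I_n}) p :
  definable S X -> definable S (fun x => X x /\ agree E x p).
Proof.
move=> dX; apply: definable_and => //.
by apply: (definable_agree hdlo); coords.
Qed.

(** By (A) the projection to the single coordinate [i] is still discrete. *)
Lemma discrete_not_shadow n (Z : set 'rV[M]_n) i : definable S Z -> Z !=set0 ->
  discrete_in Z -> ~ has_itv (fun y => exists2 x, Z x & x ord0 i = y).
Proof.
move=> dZ Z0 disZ; apply: (coord_not_itv hdlo); apply: hA => // a b.
by rewrite (ord1 a) (ord1 b).
Qed.

Lemma exchange n (X : set 'rV[M]_n) (E A : {set 'I_n}) i :
  definable S X -> i \notin E -> A \subset E ->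
  (forall p, X p -> ~ shadow X E i p) -> full X (i |: A) ->
  exists j, [/\ j \in E, j \notin A & full X (j |: A)].
Proof.
move=> dX iE AE nE fX.
have iA : i \notin A by apply: contra iE; apply: (fintype.subsetP AE).
(* A pointwise choice of [j] is enough: there are finitely many [j], so [full_exists] finds one that
   serves on a full set. *)
suff sub : shadow X A i `<=`
    (fun z => exists j, (j \in E /\ j \notin A) /\ shadow X A j z).
  have [||j fj] := full_exists hdlo hB hvisc (A := A)
      (X := fun j z => (j \in E /\ j \notin A) /\ shadow X A j z).
  - by move=> j; apply: (definable_guard inh) => _; apply: definable_shadow.
  - exact: fullS sub (fintype.subxx _) (full_shadow iA fX).
  have [_ [[jE jA] _]] := full_nonempty hdlo fj.
  exists j; split=> //; apply: (full_setU1 hdlo hB dX jA).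
  by apply: fullS fj => // z [].
move=> z sz; apply: contrapT => /forallNP nj.
(* The section of [X] over [z], projected to [E] and [i] and put back in [M^n] with the remaining
   coordinates of [z]. Freezing these makes discreteness of [Z] that of the projection. *)
pose Z w := (exists x, X x /\ agree A x z /\ agree (i |: E) x w) /\
            agree (~: (i |: E)) w z.
have dZ : definable S Z.
  apply: definable_and; last first.
    by apply: (definable_agree hdlo); coords.
  apply: (definable_exists inh); apply: definable_and.
    by apply: (definable_comp inh dX); coords.
  apply: definable_and; by apply: (definable_agree hdlo); coords.
have proj x : X x -> agree A x z -> exists w, Z w /\ w ord0 i = x ord0 i.
  move=> Xx xz; exists (\row_j if j \in i |: E then x ord0 j else z ord0 j)%R.
  rewrite mxE finset.setU11; split=> //; split=> [|j jE]; last first.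
    by rewrite mxE; move: jE; rewrite finset.in_setC => /negPf ->.
  by exists x; split=> //; split=> // j jE; rewrite mxE jE.
have Z0 : Z !=set0.
  have [l [r [lr H]]] := sz; have [y [ly yr]] := dlo_dense hdlo lr.
  by have [x [Xx [xz _]]] := H y ly yr; have [w [Zw _]] := proj x Xx xz; exists w.
suff disZ : discrete_in Z.
  apply: (@discrete_not_shadow _ Z i) => //.
  apply: has_itvS sz => y [x [Xx [xz <-]]].
  by have [w [Zw wi]] := proj x Xx xz; exists w.
apply: discrete_in_box => w [[x [Xx [xz xw]]] wz].
have ZA v : Z v -> agree A v z.
  move=> [[x' [_ [x'z x'v]]] _] j jA; rewrite -x'z// x'v// !inE.
  by rewrite (fintype.subsetP AE j jA) orbT.
have nXi : ~ shadow X E i w.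
  move=> H; apply: (nE x Xx); apply: shadow_agree H.
  by apply: agree_sym; apply: agreeS xw; apply: finset.subsetUr.
(* The sides of a box isolating [w] in [Z]. For [j] in [E] the coordinate is isolated outright; for
   [i] the isolating interval concerns the fiber over the [E]-coordinates of [w], so it applies only
   once [v] agrees with [w] on [E]. *)
have /choice[lr Hlr] : forall j, exists lr : M * M,
    [/\ (lr.1 < w ord0 j)%O, (w ord0 j < lr.2)%O &
    forall v, Z v -> (lr.1 < v ord0 j)%O -> (v ord0 j < lr.2)%O ->
      agree E v w \/ j \in E -> v ord0 j = w ord0 j].
  move=> j.
  have [jiE|jiE] := boolP (j \in i |: E); last first.
    have [l lw] := dlo_below hdlo (w ord0 j).
    have [r wr] := dlo_above hdlo (w ord0 j).
    exists (l, r); split=> // v [_ vz] _ _ _.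
    by rewrite (vz j) ?(wz j)//; rewrite finset.in_setC.
  have [jA|jA] := boolP (j \in A).
    have [l lw] := dlo_below hdlo (w ord0 j).
    have [r wr] := dlo_above hdlo (w ord0 j).
    exists (l, r); split=> // v Zv _ _ _.
    by rewrite (ZA v Zv j jA) (ZA w _ j jA)//; split=> //; exists x.
  have [jE|jE] := boolP (j \in E).
    have [l [r [lw wr H]]] := isolating_itv hdlo hvisc (w ord0 j)
      (definable1_section hdlo A z j dX) (fun H => nj j (conj (conj jE jA) H)).
    exists (l, r); split=> // v [[x' [Xx' [x'z x'v]]] _] lv vr _.
    by apply: H => //; exists x'; split=> //; split=> //; apply: x'v.
  have ji : j = i by move: jiE; rewrite !inE (negPf jE) orbF => /eqP.
  rewrite {}ji {j jiE jA} in jE *.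
  have [l [r [lw wr H]]] := isolating_itv hdlo hvisc (w ord0 i)
      (definable1_section hdlo E w i dX) nXi.
  exists (l, r); split=> // v [[x' [Xx' [x'z x'v]]] _] lv vr [vw|//].
    apply: H => //; exists x'; split=> //; split.
      by apply: agree_trans vw; apply: agreeS x'v; apply: finset.subsetUr.
    by apply: x'v; apply: finset.setU11.
exists (\row_j (lr j).1)%R, (\row_j (lr j).2)%R; split.
  by move=> j; rewrite !mxE; have [] := Hlr j.
move=> v Zv bv; have vE : agree E v w.
  move=> j jE; have [_ _ H] := Hlr j; have := bv j; rewrite !mxE => -[lv vr].
  by apply: H => //; right.
apply/rowP => j; have [_ _ H] := Hlr j; have := bv j; rewrite !mxE => -[lv vr].
by apply: H => //; left.
Qed.

(** Induction on the size of [F], removing a coordinate [i]. Where [x_i] takes values without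
    interior over the other coordinates, [exchange] replaces [i] in [D]; elsewhere the fibers lose
    one dimension and [D] at most one element. By [fullU] one of the two pieces is full on [D]. *)
Lemma full_fiber_le n (X : set 'rV[M]_n) (E F D : {set 'I_n}) k :
  definable S X -> fintype.disjoint (mem E) (mem F) ->
  (forall p (C : {set 'I_n}), X p -> C \subset F ->
    full (fun x => X x /\ agree E x p) C -> (#|C| <= k)%N) ->
  D \subset E :|: F -> full X D ->
  exists A : {set 'I_n}, [/\ A \subset E, full X A & (#|D| <= #|A| + k)%N].
Proof.
elim: {F}#|F| {-2}F (erefl #|F|) X D k => [|f IH] F cF X D k dX EF Hk DEF fD.
  move: cF => /eqP; rewrite cards_eq0 => /eqP F0.
  by exists D; rewrite F0 finset.setU0 in DEF; rewrite leq_addr.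
have /card_gt0P[i iF] : (0 < #|F|)%N by rewrite cF.
set F' := F :\ i; set EF' := E :|: F'.
have cF' : #|F'| = f by apply: succn_inj; rewrite -cF (cardsD1 i F) iF.
have F'F : F' \subset F by apply: finset.subD1set.
have EF'd : fintype.disjoint (mem E) (mem F') by apply: disjointWr EF.
have iE : i \notin E by apply/negP => iE; rewrite (disjointFr EF iE) in iF.
have iEF' : i \notin EF' by rewrite !inE (negPf iE) eqxx.
have DiEF' : D :\ i \subset EF'.
  apply/fintype.subsetP => j; rewrite !inE => /andP[ji jD].
  by have := fintype.subsetP DEF j jD; rewrite !inE ji.
pose X0 x := X x /\ ~ shadow X EF' i x.
pose X1 x := X x /\ shadow X EF' i x.
have dX0 : definable S X0.
  by apply: definable_and => //; apply/definable_not/definable_shadow.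
have dX1 : definable S X1 by apply: definable_and => //; apply: definable_shadow.
have [f0|f1] : full X0 D \/ full X1 D.
  apply: (fullU hdlo hB hvisc) => //; apply: fullS fD => // x Xx.
  by case: (EM (shadow X EF' i x)); [right|left].
(* If [i] is in [D], it is exchanged for some [j] of [EF'] outside [D], which preserves the size;
   otherwise [D] already avoids [i]. *)
- have [D2 [cD2 D2E fD2]] : exists D2 : {set 'I_n},
      [/\ #|D2| = #|D|, D2 \subset EF' & full X0 D2].
    have [iD|iD] := boolP (i \in D); last first.
      exists D; split=> //; apply/fintype.subsetP => j jD.
      apply: (fintype.subsetP DiEF'); rewrite !inE jD andbT.
      by apply: contra iD => /eqP <-.
    have [||j [jE jD fj]] := exchange dX0 iEF' DiEF'.
    - by move=> p [Xp nsp] /(shadowS (X := X0) (Y := X) (fun x H => proj1 H)).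
    - by rewrite finset.setD1K.
    exists (j |: D :\ i); split=> //; last first.
      by rewrite finset.subUset finset.sub1set jE.
    by rewrite cardsU1 jD (cardsD1 i D) iD.
  have [|A [AE fA cA]] := IH F' cF' X0 D2 k dX0 EF'd _ D2E fD2.
    move=> p C [Xp _] CF fC; apply: (Hk p) => //.
      exact: fintype.subset_trans CF F'F.
    by apply: fullS fC => // x [[]].
  by exists A; split; rewrite -?cD2//; apply: fullS fA => // x [].
(* Over [X1] the coordinate [i] can be added to any [C] full in a fiber, so the bound [k] drops by
   one. *)
- have lift p (C : {set 'I_n}) : X1 p -> C \subset F' ->
      full (fun x => X1 x /\ agree E x p) C -> (#|C| < k)%N.
    move=> [Xp _] CF' fC.
    have iC : i \notin C by apply/negP => /(fintype.subsetP CF'); rewrite !inE eqxx.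
    have -> : #|C|.+1 = #|i |: C| by rewrite cardsU1 iC.
    apply: (Hk p) => //.
      by rewrite finset.subUset finset.sub1set iF (fintype.subset_trans CF' F'F).
    apply: (full_setU1 hdlo hB) => //; first exact: definable_cylinder.
    apply: fullS fC => // x [[Xx sx] xp].
    apply: has_itvS (sx) => y [x' [Xx' [x'x x'y]]].
    exists x'; split; first split=> //.
      by apply: agree_trans xp; apply: agreeS x'x; apply: finset.subsetUl.
    split=> //; apply: agreeS x'x; apply: fintype.subset_trans CF' _.
    exact: finset.subsetUr.
  (* The empty [C] is full in a nonempty fiber, so [k.-1] below is a true predecessor. *)
  have k0 : (0 < k)%N.
    have [p X1p] := full_nonempty hdlo f1.
    have := lift p finset.set0 X1p; rewrite finset.sub0set cards0; apply=> //.
    by apply: (full0 hdlo); exists p.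
  have [||A [AE fA cA]] := IH F' cF' X1 (D :\ i) k.-1 dX1 EF'd _ DiEF' _.
  - by move=> p C X1p CF' fC; rewrite -ltnS prednK//; apply: lift fC.
  - by apply: fullS f1 => //; apply: finset.subD1set.
  exists A; split=> //; first by apply: fullS fA => // x [].
  rewrite (cardsD1 i D) -(prednK k0) addnS -add1n.
  by apply: leq_add => //; case: (_ \in _).
Qed.

(** Induction on the size of [C]: a coordinate [i] of [C] is absorbed by replacing [X] with its
    shadow over the other coordinates, whose fibers over [A] are full on [C] without [i]. *)
Lemma full_fiber_ge n (X : set 'rV[M]_n) (A C : {set 'I_n}) :
  definable S X -> fintype.disjoint (mem A) (mem C) ->
  full (fun u => full (fun x => X x /\ agree A x u) C) A -> full X (A :|: C).
Proof.
elim: {C}#|C| {-2}C (erefl #|C|) X => [|c IH] C cC X dX AC fX.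
  move: cC => /eqP; rewrite cards_eq0 => /eqP ->; rewrite finset.setU0.
  have [l [r [lr H]]] := fX; exists l, r; split=> // z /H[u [/(full_nonempty hdlo)]].
  by move=> [x [Xx xu]] uz; exists x; split=> //; apply: agree_trans uz.
have /card_gt0P[i iC] : (0 < #|C|)%N by rewrite cC.
set C' := C :\ i.
have cC' : #|C'| = c by apply: succn_inj; rewrite -cC (cardsD1 i C) iC.
have AC' : fintype.disjoint (mem A) (mem C').
  by apply: disjointWr AC; apply: finset.subD1set.
have iA : i \notin A by apply/negP => iA; rewrite (disjointFr AC iA) in iC.
have iC' : i \notin C' by rewrite !inE eqxx.
rewrite -(finset.setD1K iC) finset.setUCA -/C'.
apply: (full_setU1 hdlo hB dX); first by rewrite finset.in_setU negb_or iA.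
apply: (IH _ cC') => //; first exact: definable_shadow.
apply: fullS fX => // u; rewrite -(finset.setD1K iC) -/C' => /(full_shadow iC').
move=> [l [r [lr H]]]; exists l, r; split=> // z /H[v [sv vz]].
have wu : agree A (\row_j if j \in A then u ord0 j else v ord0 j)%R u.
  by move=> j jA; rewrite mxE jA.
have wv : agree C' (\row_j if j \in A then u ord0 j else v ord0 j)%R v.
  by move=> j jC; rewrite mxE (disjointFl AC' jC).
(* The point [v] is only controlled on [C']; it is corrected on [A] to lie in the fiber over [u]. *)
exists (\row_j if j \in A then u ord0 j else v ord0 j)%R.
split; last exact: agree_trans vz.
split=> //; apply: has_itvS (sv) => y [x [[Xx xu] [xv xy]]].
exists x; split=> //; split=> // j; rewrite inE => /orP[jA|jC].
  by rewrite wu// xu.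
by rewrite wv// xv.
Qed.

End Additivity.

(** * Dimension as the largest size of a full set of coordinates *)

Section Rank.
Context (disp : Order.disp_t) (M : orderTopologicalType disp).
Context (hdlo : dense_linear_order_without_endpoints M).
Let inh := dlo_inhabited hdlo.

(** On the empty set this is the default [0] rather than minus infinity, hence the nonemptiness
    hypotheses below. *)
Definition rank n (X : set 'rV[M]_n) : nat :=
  \max_(A : {set 'I_n} | `[< full X A >]) #|A|.

Lemma full_rank n (X : set 'rV[M]_n) A : full X A -> (#|A| <= rank X)%N.
Proof. by move=> fA; apply: leq_bigmax_cond; apply/asboolP. Qed.

Lemma rank_full n (X : set 'rV[M]_n) : X !=set0 ->
  exists2 A, full X A & #|A| = rank X.
Proof.
move=> X0; have := @eq_bigmax_cond _ [pred A | `[< full X A >]] (fun A => #|A|).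
case=> [|A]; first by apply/card_gt0P; exists finset.set0; apply/asboolP/full0.
by move=> /asboolP fA cA; exists A.
Qed.

Lemma increasing_inj n d (s : 'I_d -> 'I_n) : increasing s -> injective s.
Proof.
move=> sI i j sij; have [ij|ji|/val_inj//] := ltngtP i j.
  by have := sI _ _ ij; rewrite sij ltnn.
by have := sI _ _ ji; rewrite sij ltnn.
Qed.

Lemma increasing_enum_val n (A : {set 'I_n}) :
  increasing (@enum_val _ (mem A)).
Proof.
move=> i j ij.
have ltT : transitive (relpre (@nat_of_ord n) ltn) by move=> a b c; apply: ltn_trans.
have srt : sorted (relpre (@nat_of_ord n) ltn) (enum A).
  rewrite /enum_mem -enumT; apply: sorted_filter => //.
  by rewrite -sorted_map val_enum_ord iota_ltn_sorted.
have := sorted_ltn_nth ltT (enum_val i) srt => /(_ i j).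
by rewrite !inE -!cardE !ltn_ord -!enum_val_nth; apply.
Qed.

(** An increasing [s] corresponds to its image, and a set of coordinates to its increasing
    enumeration [enum_val]. *)
Lemma top_dimE n (X : set 'rV[M]_n) : X !=set0 ->
  top_dim X = ((rank X)%:Z)%:E%E.
Proof.
move=> X0; rewrite /top_dim; case: eqP => [X00|_].
  by move: X0; rewrite X00 => -[].
congr (_%:Z%:E)%E; apply/eqP; rewrite eqn_leq; apply/andP; split.
  apply/bigmax_leqP => d /asboolP[s [/increasing_inj sI hs]].
  rewrite -[X in (X <= _)%N]card_ord -cardsT -(card_imset _ sI).
  by apply/full_rank/full_imset => //; apply/full_setT.
have [A fA <-] := rank_full X0.
have cA : (#|A| < n.+1)%N by rewrite ltnS -[X in (_ <= X)%N]card_ord max_card.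
apply: (@leq_bigmax_cond _ _ _ (Ordinal cA)); apply/asboolP.
exists (@enum_val _ (mem A)); split; first exact: increasing_enum_val.
apply/(full_setT hdlo)/(full_imset hdlo); first exact: enum_val_inj.
suff -> : (@enum_val _ (mem A)) @: [set: 'I_#|A|]%SET = A by [].
apply/finset.setP => j; apply/imsetP/idP => [[k _ ->]|jA]; first exact: enum_valP.
by exists (enum_rank_in jA j); rewrite ?enum_rankK_in.
Qed.

Lemma has_itv_neq (P : set M) : has_itv P -> exists x y, [/\ P x, P y & x <> y].
Proof.
move=> [l [r [lr H]]]; have [x [lx xr]] := dlo_dense hdlo lr.
have [y [xy yr]] := dlo_dense hdlo xr; exists x, y; split; first exact: H.
  by apply: H => //; apply: lt_trans xy.
by move=> e; rewrite e ltxx in xy.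
Qed.

Context (L : language) (S : expansion L M) (hvisc : locally_l_visceral S)
  (hA : propertyA S) (hB : propertyB S).

Lemma rankU n (X Y : set 'rV[M]_n) : definable S X -> definable S Y ->
  X !=set0 -> Y !=set0 -> rank (X `|` Y) = maxn (rank X) (rank Y).
Proof.
move=> dX dY X0 Y0; apply/eqP; rewrite eqn_leq geq_max; apply/and3P; split.
- have [|A fA <-] := @rank_full _ (X `|` Y).
    by case: X0 => x Xx; exists x; left.
  rewrite leq_max; have [/full_rank->//|/full_rank->] :=
    fullU hdlo hB hvisc dX dY fA.
  by rewrite orbT.
- have [A fA <-] := rank_full X0; apply: full_rank.
  by apply: fullS fA => // x; left.
- have [A fA <-] := rank_full Y0; apply: full_rank.
  by apply: fullS fA => // x; right.
Qed.

(** * The graph of a map, with source coordinates [E1] and target coordinates [E2] *)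

Section Graph.
Context (m n : nat) (X : set 'rV[M]_m) (f : 'rV[M]_m -> 'rV[M]_n).
Context (dG : definable_map S X f).

Let G : set 'rV[M]_(m + n) := [set row_mx x (f x) | x in X].
Let E1 : {set 'I_(m + n)} := (lshift n @: [set: 'I_m])%SET.
Let E2 : {set 'I_(m + n)} := (@rshift m n @: [set: 'I_n])%SET.

Let E12 : fintype.disjoint (mem E1) (mem E2).
Proof.
rewrite fintype.disjoint_subset; apply/fintype.subsetP => _ /imsetP[j _ ->].
by rewrite inE; apply/imsetP => -[k _ /eqP]; rewrite eq_lrshift.
Qed.

Let sub1P (C : {set 'I_(m + n)}) :
  C \subset E1 -> exists C' : {set 'I_m}, C = lshift n @: C'.
Proof.
move=> CE; exists (lshift n @^-1: C); apply/finset.setP => j.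
apply/idP/imsetP => [jC|[k]]; last by rewrite inE => kC ->.
have /imsetP[k _ jk] := fintype.subsetP CE j jC.
by exists k; rewrite // inE -jk.
Qed.

Let sub2P (C : {set 'I_(m + n)}) :
  C \subset E2 -> exists C' : {set 'I_n}, C = @rshift m n @: C'.
Proof.
move=> CE; exists (@rshift m n @^-1: C); apply/finset.setP => j.
apply/idP/imsetP => [jC|[k]]; last by rewrite inE => kC ->.
have /imsetP[k _ jk] := fintype.subsetP CE j jC.
by exists k; rewrite // inE -jk.
Qed.

Let sub1 (C : {set 'I_m}) : lshift n @: C \subset E1.
Proof. by apply: imsetS; apply: finset.subsetT. Qed.

Let sub2 (C : {set 'I_n}) : @rshift m n @: C \subset E2.
Proof. by apply: imsetS; apply: finset.subsetT. Qed.

Let projl x : coord_proj (lshift n) (row_mx x (f x)) = x.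
Proof. by apply/rowP => j; rewrite mxE row_mxEl. Qed.

Let projr x : coord_proj (@rshift m n) (row_mx x (f x)) = f x.
Proof. by apply/rowP => j; rewrite mxE row_mxEr. Qed.

Let full1 (C : {set 'I_m}) : full G (lshift n @: C) <-> full X C.
Proof.
rewrite (full_imset hdlo _ _ (@lshift_inj _ _)).
suff -> : coord_proj (lshift n) @` G = X by [].
apply/seteqP; split=> [_ [_ [x Xx <-] <-]|x Xx]; first by rewrite projl.
by exists (row_mx x (f x)) => //; exists x.
Qed.

Let full2 (C : {set 'I_n}) : full G (@rshift m n @: C) <-> full (f @` X) C.
Proof.
rewrite (full_imset hdlo _ _ (@rshift_inj _ _)).
suff -> : coord_proj (@rshift m n) @` G = f @` X by [].
apply/seteqP; split=> [_ [_ [x Xx <-] <-]|_ [x Xx <-]].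
  by rewrite projr; exists x.
by exists (row_mx x (f x)) => //; exists x.
Qed.

(** Agreement with [p] on the target block forces the value of [f], so the fiber of the graph
    projects onto the fiber of [f]. *)
Let full_fib p (C : {set 'I_m}) : G p ->
  full (fun x => G x /\ agree E2 x p) (lshift n @: C) <->
  full (X `&` f @^-1` [set rsubmx p]) C.
Proof.
move=> [x0 _ <-]; rewrite row_mxKr (full_imset hdlo _ _ (@lshift_inj _ _)).
suff -> : coord_proj (lshift n) @` (fun x => G x /\ agree E2 x (row_mx x0 (f x0)))
  = X `&` f @^-1` [set f x0] by [].
apply/seteqP; split=> [_ [_ [[x Xx <-] xx0] <-]|x [Xx /= fx]].
  rewrite projl; split=> //=; apply/rowP => j.
  by have := xx0 (rshift m j) (imset_f _ (finset.in_setT _)); rewrite !row_mxEr.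
exists (row_mx x (f x)) => //; split; first by exists x.
by move=> _ /imsetP[j _ ->]; rewrite !row_mxEr fx.
Qed.

(* The fibers of the graph over X are singletons. *)
Let full_graph_rank (D : {set 'I_(m + n)}) : full G D -> (#|D| <= rank X)%N.
Proof.
move=> fD.
have [p C Gp CE fC||//|A [AE fA cA]] :=
  full_fiber_le hdlo hvisc hA hB (k := 0) (D := D) dG E12.
(* An element [j] of [C] would give two points of one fiber with different [j]-th coordinates, yet
   both are the graph point over the same source point. *)
- rewrite leqn0 cards_eq0; apply/negP => /negP/set0Pn[j jC].
  move: fC; rewrite -(finset.setD1K jC) => /full_shadow.
  rewrite !inE eqxx => /(_ isT).
  move=> /(full_nonempty hdlo)[z /has_itv_neq[y [y' [+ + yy']]]].
  case=> [x [[[u Xu <-] up] [_ xj]]] [_ [[[u' Xu' <-] up'] [_ xj']]].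
  apply: yy'; rewrite -xj -xj'; suff -> : u = u' by [].
  apply/rowP => k; have kE : lshift n k \in E1 by apply: imset_f; rewrite inE.
  by have := up _ kE; rewrite -(up' _ kE) !row_mxEl.
- apply/fintype.subsetP => j _; rewrite inE.
  case: (splitP j) => k jk; apply/orP; [left|right]; apply/imsetP; exists k => //;
  exact/val_inj.
have [A' AA'] := sub1P AE; rewrite addn0 in cA.
apply: leq_trans cA _; move: fA; rewrite AA' => /full1/full_rank.
by rewrite card_imset//; apply: lshift_inj.
Qed.

(** A set on which the image is full becomes a set of target coordinates on which the graph is full,
    and the graph has rank at most that of [X]. *)
Lemma rank_image : X !=set0 -> (rank (f @` X) <= rank X)%N.
Proof.
move=> [x Xx]; have [|A fA <-] := @rank_full _ (f @` X).
  by exists (f x); exists x.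
rewrite -(card_imset _ (@rshift_inj m n)).
by apply: full_graph_rank; apply/full2.
Qed.

(** The addition formula for the graph, with the target block as base and the source block as
    fiber. *)
Lemma rank_fibers k : X !=set0 ->
  (forall y, (f @` X) y -> rank (X `&` f @^-1` [set y]) = k) ->
  rank X = (rank (f @` X) + k)%N.
Proof.
move=> X0 Hk; have G2 p : G p -> (f @` X) (rsubmx p).
  by move=> [x Xx <-]; rewrite row_mxKr; exists x.
apply/eqP; rewrite eqn_leq; apply/andP; split.
  have [A fA <-] := rank_full X0.
  have [|p C Gp /sub1P[C' ->]|||B [/sub2P[B' ->] /full2 fB cB]] :=
    full_fiber_le hdlo hvisc hA hB (k := k) (E := E2) (F := E1)
      (D := lshift n @: A) dG.
  - by rewrite fintype.disjoint_sym.
  - move=> /(full_fib _ Gp)/full_rank; rewrite (Hk _ (G2 _ Gp)).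
    by rewrite card_imset//; apply: lshift_inj.
  - exact: fintype.subset_trans (sub1 A) (finset.subsetUr _ _).
  - exact/full1.
  rewrite !card_imset in cB; [|exact: rshift_inj|exact: lshift_inj].
  by apply: leq_trans cB _; rewrite leq_add2r; apply: full_rank.
have [|A fA <-] := @rank_full _ (f @` X).
  by case: X0 => x Xx; exists (f x); exists x.
(* Each point of the graph has a set [C] of size [k] on which its fiber is full. There are finitely
   many candidates, so one [C] serves over a full part of the base. The size is kept in the family
   to be recovered afterwards. *)
have [||C fC] := full_exists hdlo hB hvisc (A := @rshift m n @: A)
  (X := fun (C : {set 'I_m}) p => #|C| = k /\
     (G p /\ full (fun x => G x /\ agree E2 x p) (lshift n @: C))).
- move=> C; apply: (definable_guard inh) => _; apply: definable_and => //.
  apply: (definable2_full hdlo); apply: definable_and.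
    by apply: (definable_comp inh dG); coords.
  by apply: (definable_agree hdlo); coords.
- move/full2 : fA; apply: fullS => // p Gp.
  have [|C fC cC] := @rank_full _ (X `&` f @^-1` [set rsubmx p]).
    by case: (Gp) => x Xx <-; exists x; rewrite row_mxKr.
  exists C; split; first by rewrite cC; apply: Hk; apply: G2.
  by split=> //; apply/full_fib.
have [_ [cC _]] := full_nonempty hdlo fC.
rewrite -cC -(card_imset _ (@rshift_inj m n)) -(card_imset C (@lshift_inj m n)).
have dis : fintype.disjoint (mem (@rshift m n @: A)) (mem (lshift n @: C)).
  rewrite fintype.disjoint_sym; apply: disjointWl (sub1 C) _.
  by apply: disjointWr (sub2 A) _.
have -> : (#|@rshift m n @: A| + #|lshift n @: C| =
    #|@rshift m n @: A :|: lshift n @: C|)%N.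
  by rewrite cardsU disjoint_setI0// cards0 subn0.
apply: full_graph_rank; apply: (full_fiber_ge hdlo hB dG dis).
apply: fullS fC => // p [_ [Gp]]; apply: fullS => // x [Gx xp]; split=> //.
by apply: agreeS xp.
Qed.

End Graph.
End Rank.

(** * The three statements, obtained from [rank] through [top_dimE] *)

Theorem theorem4p9 (disp : Order.disp_t) (M : orderTopologicalType disp)
    (L : language) (S : expansion L M)
    (hdlo : dense_linear_order_without_endpoints M)
    (hvisc : locally_l_visceral S) (hA : propertyA S) (hB : propertyB S) :
  [/\ forall (n : nat) (X Y : set 'rV[M]_n),
        definable S X -> definable S Y -> X !=set0 -> Y !=set0 ->
        top_dim (X `|` Y) = maxe (top_dim X) (top_dim Y),
      forall (m n : nat) (X : set 'rV[M]_m) (Y : set 'rV[M]_n)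
          (phi : 'rV[M]_m -> 'rV[M]_n),
        definable S X -> definable S Y -> X !=set0 -> Y !=set0 ->
        definable_map S X phi -> phi @` X = Y ->
        (forall y y', Y y -> Y y' ->
          top_dim (X `&` phi @^-1` [set y]) = top_dim (X `&` phi @^-1` [set y'])) ->
        forall y, Y y ->
          top_dim X = (top_dim Y + top_dim (X `&` phi @^-1` [set y]))%E
    & forall (m n : nat) (X : set 'rV[M]_m) (f : 'rV[M]_m -> 'rV[M]_n),
        definable S X -> X !=set0 -> definable_map S X f ->
        (top_dim (f @` X) <= top_dim X)%E].
Proof.
split=> [n X Y dX dY X0 Y0|m n X _ phi dX _ X0 _ dG <- Hk y Yy|m n X f dX X0 dG].
- have XY0 : (X `|` Y) !=set0 by case: X0 => x Xx; exists x; left.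
  rewrite !(top_dimE hdlo)// (rankU hdlo hvisc hB dX dY X0 Y0).
  rewrite -EFin_max; congr (_%:E)%E.
  by case: leqP => [?|/ltnW ?]; [rewrite max_r|rewrite max_l].
- have fib0 z : (phi @` X) z -> (X `&` phi @^-1` [set z]) !=set0.
    by move=> [x Xx <-]; exists x.
  have Y0 : (phi @` X) !=set0 by exists y.
  rewrite !(top_dimE hdlo)//; last exact: fib0.
  rewrite (@rank_fibers _ _ hdlo _ _ hvisc hA hB _ _ _ _ dG
    (rank (X `&` phi @^-1` [set y])))//.
  move=> z Yz; have := Hk z y Yz Yy; rewrite !(top_dimE hdlo); last 2 first.
  + exact: fib0.
  + exact: fib0.
  by move=> [].
- have fX0 : (f @` X) !=set0 by case: X0 => x Xx; exists (f x); exists x.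
  rewrite !(top_dimE hdlo)// lee_fin.
  by have := rank_image hdlo hvisc hA hB dG X0.
Qed.
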